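(* Let $n=2k+1$ for some integer $k\ge 2$, and put $l=\left\lfloor \frac{n-4}{4}\right\rfloor$. Then $$\psi_4(2k+1)=(l+1)k^2-2(l+1)^2k+\frac{(2l+1)(2l+3)(l+1)}{3}.$$
   Context: The wheel $W_n$ is the join of the cycle $C_n$ (the outer cycle) and a single vertex: $V(W_n)=\{v,v_1,\dots,v_n\}$ and $E(W_n)=\{vv_i,\ v_iv_{i+1} : 1\le i\le n\}$ with subscripts modulo $n$; the outer cycle $C_n$ has edges $v_iv_{i+1}$. A signed graph $\Sigma=(G,\sigma)$ is a graph $G$ together with a function $\sigma:E(G)\to\{+1,-1\}$; an edge $e$ is negative if $\sigma(e)=-1$. Switching $\Sigma$ at a vertex $u$ changes the sign of every edge incident to $u$. Two signed graphs are isomorphic if there is a graph isomorphism between their underlying graphs preserving edge signs. Two signed graphs are switching isomorphic if one is isomorphic to a signed graph obtained from the other by a sequence of switchings. $(W_n,\sigma)^o$ denotes a signed wheel all of whose negative edges lie on the outer cycle $C_n$. For $0\le p\le n$, $\psi_p(n)$ denotes the number of switching non-isomorphic signed wheels of the form $(W_n,\sigma)^o$ with exactly $p$ negative edges (the number of equivalence classes of such signed wheels under switching isomorphism). *)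

(* Defs.v *)
From mathcomp Require Import all_boot.

Set Implicit Arguments.
Unset Strict Implicit.
Unset Printing Implicit Defensive.

Record sgraph := SGraph {
  vertex :> finType;
  adj : rel vertex;
  adj_sym : symmetric adj;
  adj_irrefl : irreflexive adj }.

Definition edge_set (G : sgraph) : {set {set G}} :=
  [set e | [exists x : G, exists y : G, adj x y && (e == [set x; y])]].

Definition edge (G : sgraph) := {e : {set G} | e \in edge_set G}.

(* A sign is encoded by a boolean b standing for (-1) ^+ b: true is -1. *)
Definition signature (G : sgraph) := {ffun edge G -> bool}.

Definition neg_edges (G : sgraph) (s : signature G) : {set edge G} :=
  [set d | s d].

Definition switch (G : sgraph) (u : G) (s : signature G) : signature G :=
  [ffun d : edge G => s d (+) (u \in val d)].

(* [connect] is the reflexive transitive closure, so this says that t is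
   obtained from s by a finite, possibly empty, sequence of switchings. *)
Definition switching_equiv (G : sgraph) : rel (signature G) :=
  connect (fun s t : signature G => [exists u : G, t == switch u s]).

Definition graph_iso (G H : sgraph) (f : {ffun G -> H}) : bool :=
  [&& injectiveb f, [forall y : H, exists x : G, f x == y]
    & [forall x : G, forall y : G, adj (f x) (f y) == adj x y]].

Definition signed_iso (G H : sgraph) (s : signature G) (t : signature H) :
    bool :=
  [exists f : {ffun G -> H}, graph_iso f &&
    [forall d : edge G, forall d' : edge H,
      (val d' == f @: val d) ==> (t d' == s d)]].

Definition switching_iso (G H : sgraph) (s : signature G) (t : signature H) :
    bool :=
  [exists t' : signature H, switching_equiv t t' && signed_iso s t'].

(* None is the hub and Some i a rim vertex; ordS is the successor modulo n.
   The conjunct i != j only matters for n = 1, where it removes a loop. *)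
Definition wheel_adj (n : nat) (x y : option 'I_n) : bool :=
  match x, y with
  | None, None => false
  | Some i, Some j => (i != j) && ((j == ordS i) || (i == ordS j))
  | _, _ => true
  end.

Lemma wheel_adj_sym n : symmetric (@wheel_adj n).
Proof. by case=> [i|] [j|] //=; rewrite eq_sym orbC. Qed.

Lemma wheel_adj_irrefl n : irreflexive (@wheel_adj n).
Proof. by case=> [i|] //=; rewrite eqxx. Qed.

Definition wheel (n : nat) : sgraph :=
  SGraph (@wheel_adj_sym n) (@wheel_adj_irrefl n).

Definition outer_edges (n : nat) : {set edge (wheel n)} :=
  [set d | [exists i : 'I_n, val d == [set Some i; Some (ordS i)]]].

Definition outer_signatures (p n : nat) : {set signature (wheel n)} :=
  [set s | (neg_edges s \subset outer_edges n) && (#|neg_edges s| == p)].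

Definition psi (p n : nat) : nat :=
  #|equivalence_partition (@switching_iso (wheel n) (wheel n))
      (outer_signatures p n)|.

(* Main.v *)
(** The sign of the triangle on a rim edge is invariant under switching, and it
    is the sign of the rim edge itself when all spokes are positive.  A wheel
    automorphism fixes the hub and acts dihedrally on the rim, so the classes
    counted by [psi p n] are the dihedral orbits of the [p]-subsets of [Z/n].
    Burnside's lemma counts them: for [n] odd and [p = 4], a rotation by [a]
    fixes no 4-set unless [a = 0] (the sum of the elements would give [4 a = 0]),
    and each of the [n] reflections fixes exactly ['C(k, 2)] of them, whence
    [2 n psi = 'C(n, 4) + n 'C(k, 2)] and [psi = 'C(k + 1, 3)]. *)
Require Import Defs.
From mathcomp Require Import all_boot all_order all_algebra all_fingroup.
From mathcomp Require Import ring zify.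

Import GRing.Theory Num.Theory.
Local Open Scope ring_scope.

(** * The dihedral group acting on Z/(m+2) *)

(** The size is written [m.+2] because ['I_m.+2] carries the ring structure of Z/(m+2). *)
Definition dihedral_fun (m : nat) (b : bool) (a i : 'I_m.+2) : 'I_m.+2 :=
  a + (if b then - i else i).

Lemma dihedral_fun_inj (m : nat) (b : bool) (a : 'I_m.+2) :
  injective (@dihedral_fun m b a).
Proof. by case: b => i j /addrI; [apply: oppr_inj|]. Qed.

Definition dihedral_perm (m : nat) (b : bool) (a : 'I_m.+2) : {perm 'I_m.+2} :=
  perm (@dihedral_fun_inj m b a).

Definition dihedral_set (m : nat) : {set {perm 'I_m.+2}} :=
  [set dihedral_perm m u.1 u.2 | u in [set: bool * 'I_m.+2]].

Lemma dihedral_permE (m : nat) (b : bool) (a i : 'I_m.+2) :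
  dihedral_perm m b a i = a + (if b then - i else i).
Proof. by rewrite permE. Qed.

Lemma mem_dihedral (m : nat) (b : bool) (a : 'I_m.+2) :
  dihedral_perm m b a \in dihedral_set m.
Proof. by apply/imsetP; exists (b, a); rewrite ?inE. Qed.

Lemma group_set_dihedral (m : nat) : group_set (dihedral_set m).
Proof.
apply/group_setP; split.
  suff -> : 1%g = dihedral_perm m false 0 by apply: mem_dihedral.
  by apply/permP=> i; rewrite perm1 dihedral_permE add0r.
move=> _ _ /imsetP[[b a] _ ->] /imsetP[[c d] _ ->] /=.
(* Products of permutations apply the left factor first, so 0 goes to the image of [a] under the
   second factor; the reflection bits add. *)
suff -> : (dihedral_perm m b a * dihedral_perm m c d)%g
        = dihedral_perm m (b (+) c) (dihedral_perm m c d a).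
  exact: mem_dihedral.
apply/permP=> i; rewrite permM !dihedral_permE.
by case: b c => [] [] /=; rewrite ?opprD ?opprK !addrA.
Qed.

Canonical dihedral_group (m : nat) : {group {perm 'I_m.+2}} :=
  Group (@group_set_dihedral m).

Lemma Zp_natr_neq0 (m q : nat) : (0 < q < m.+2)%N -> (q%:R : 'I_m.+2) != 0.
Proof.
move=> /andP[q_gt0 lt]; rewrite -(inj_eq val_inj) /= (@val_Zp_nat m.+2) //.
by rewrite modn_small // -lt0n.
Qed.

Lemma two_neq0 (m : nat) : (0 < m)%N -> (1 + 1 : 'I_m.+2) != 0.
Proof. exact: (@Zp_natr_neq0 m 2). Qed.

(** The value at 0 recovers the constant, and the value at 1 then recovers the sign, because 1 and
    -1 differ modulo [m.+2 >= 3]. *)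
Lemma dihedral_perm_inj (m : nat) : (0 < m)%N ->
  injective (fun u : bool * 'I_m.+2 => dihedral_perm m u.1 u.2).
Proof.
move=> m_gt0 [b a] [c d] /= /permP e.
have := e 0; rewrite !dihedral_permE oppr0 !if_same !addr0 => ead; subst d.
have N1 : (1 == - 1 :> 'I_m.+2) = false.
  by rewrite -addr_eq0 (negPf (@two_neq0 m m_gt0)).
have := e 1; rewrite !dihedral_permE => /addrI/eqP.
by case: b c {e} => [] [] //=; rewrite ?N1 // eq_sym N1.
Qed.

Lemma sum_dihedral (m : nat) (F : {perm 'I_m.+2} -> nat) : (0 < m)%N ->
  (\sum_(g in dihedral_set m) F g =
   \sum_(a : 'I_m.+2) F (dihedral_perm m false a)
   + \sum_(a : 'I_m.+2) F (dihedral_perm m true a))%N.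
Proof.
move=> m_gt0; rewrite big_imset /=; last first.
  by move=> u v _ _; apply: dihedral_perm_inj.
rewrite (eq_bigl xpredT) => [|u]; last by rewrite inE.
rewrite -(pair_bigA _ (fun b a => F (dihedral_perm m b a))) /=.
by rewrite big_bool /= addnC.
Qed.

Lemma card_dihedral (m : nat) : (0 < m)%N -> #|dihedral_set m| = m.+2.*2.
Proof.
move=> m_gt0; rewrite -sum1_card sum_dihedral // !sum1_card.
by rewrite card_ord addnn.
Qed.

(** * Invariant subsets and the Burnside count *)

Definition draws (m p : nat) : {set {set 'I_m.+2}} := [set A : {set _} | #|A| == p].

Lemma acts_draws (m p : nat) :
  [acts dihedral_set m, on draws m p | ('P)^*].
Proof.
apply/actsP=> g _ A; rewrite !inE /=; congr (_ == _).
by rewrite /setact card_imset // => x y /perm_inj.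
Qed.

Lemma fix_drawsE (m p : nat) (g : {perm 'I_m.+2}) :
  'Fix_(draws m p | ('P)^*)[g]%g = [set A in draws m p | g @: A == A].
Proof.
apply/setP=> A; rewrite in_setI [RHS]in_set; congr (_ && _).
apply/afix1P/eqP=> /=; by rewrite /setact.
Qed.

Lemma mulrn_coprime_inj (m q : nat) (x y : 'I_m.+2) :
  coprime m.+2 q -> x *+ q = y *+ q -> x = y.
Proof.
move=> co; rewrite -(mulr_natr x) -(mulr_natr y).
by apply: mulIr; rewrite (@unitZpE m.+2).
Qed.

Lemma rotation_fix (m p : nat) (a : 'I_m.+2) : coprime m.+2 p ->
  #|'Fix_(draws m p | ('P)^*)[dihedral_perm m false a]%g|
  = if a == 0 then 'C(m.+2, p) else 0%N.
Proof.
move=> co; rewrite fix_drawsE; case: eqP => [->|/eqP a0].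
  have -> : [set A in draws m p | dihedral_perm m false 0 @: A == A]
          = draws m p.
    apply/setP=> A; rewrite inE andb_idr // => _; apply/eqP.
    rewrite -[RHS]imset_id; apply: eq_imset => i.
    by rewrite dihedral_permE add0r.
  by rewrite card_draws card_ord.
apply: eq_card0 => A; rewrite !inE; apply/negP=> /andP[/eqP cA /eqP fA].
case/eqP: a0; apply: (mulrn_coprime_inj m p) => //; rewrite mul0rn.
(* Reindexing the sum of the elements of the invariant set [A] along the rotation adds [a] once per
   element, [p] times in all. *)
apply: (@addIr _ (\sum_(i in A) i)); rewrite add0r -{2}fA big_imset /=.
  rewrite -cA -sumr_const -big_split /=.
  by apply: eq_bigr => i _; rewrite dihedral_permE.
by move=> x y _ _ /perm_inj.
Qed.

(** For [m] odd this picks one element from each pair {x, -x} of nonzero residues. *)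
Definition lower_half (m : nat) : {set 'I_m.+2} :=
  [set i : 'I_m.+2 | (0 < i)%N && (i <= m./2.+1)%N].

Lemma lower_halfN (m : nat) (i : 'I_m.+2) : odd m ->
  (- i \in lower_half m) = (i != 0) && (i \notin lower_half m).
Proof.
move=> om; rewrite !inE -(inj_eq val_inj) /=.
have := ltn_ord i; case: (val i) => [|j] lt /=; first by rewrite subn0 modnn.
have e := odd_double_half m; rewrite om in e.
by rewrite modn_small; lia.
Qed.

Lemma card_lower_half (m : nat) : odd m -> #|lower_half m| = m./2.+1.
Proof.
move=> om.
pose f (i : 'I_m./2.+1) : 'I_m.+2 := inord i.+1.
have e := odd_double_half m; rewrite om in e.
have fE (i : 'I_m./2.+1) : f i = i.+1 :> nat.
  by rewrite inordK //; have := ltn_ord i; lia.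
suff -> : lower_half m = f @: setT.
  rewrite card_imset ?cardsT ?card_ord // => i j fij.
  by apply/val_inj/succn_inj; rewrite /= -!fE fij.
apply/setP=> i; apply/idP/imsetP => [|[j _ ->]]; last first.
  by rewrite inE fE /=.
rewrite inE => /andP[i0 il].
have lt : (i.-1 < m./2.+1)%N by lia.
by exists (Ordinal lt); rewrite ?inE //; apply: ord_inj; rewrite fE /= prednK.
Qed.

(** Modulo an odd number, negation fixes only 0, so an invariant set of even size avoids 0 and is a
    union of [p] pairs {x, -x}. It is determined by its trace on [lower_half], which can be any
    [p]-subset. *)
Lemma card_opp_invariant (m p : nat) : odd m ->
  #|[set A in draws m p.*2 | -%R @: A == A]| = 'C(m./2.+1, p).
Proof.
move=> om; rewrite -card_lower_half // -cards_draws.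
pose f (B : {set 'I_m.+2}) := B :|: -%R @: B.
have memN (B : {set 'I_m.+2}) x : (x \in -%R @: B) = (- x \in B).
  by rewrite -{1}[x]opprK mem_imset //; apply: oppr_inj.
have half0 x : x \in lower_half m -> x != 0.
  by apply: contraL => /eqP->; rewrite inE.
have fK (B : {set 'I_m.+2}) : B \subset lower_half m ->
    f B :&: lower_half m = B.
  move=> /subsetP sB; apply/setP=> x; rewrite !inE memN.
  apply/idP/idP => [/andP[/orP[//|/sB]]|xB]; last by have := sB _ xB; rewrite inE xB.
  by rewrite lower_halfN // inE => /andP[_ /negPf->].
have card_f (B : {set 'I_m.+2}) : B \subset lower_half m -> #|f B| = #|B|.*2.
  move=> /subsetP sB; rewrite cardsU card_imset; last exact: oppr_inj.
  rewrite (_ : B :&: _ = set0) ?cards0 ?subn0 ?addnn //.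
  apply/setP=> x; rewrite !inE memN; apply/negP=> /andP[/sB xH /sB].
  by rewrite lower_halfN // xH andbF.
rewrite -(@card_in_imset _ _ f); last first.
  move=> B C; rewrite !inE => /andP[sB _] /andP[sC _] e.
  by rewrite -(fK _ sB) -(fK _ sC) e.
apply: eq_card => A; apply/idP/imsetP=> [|[B]]; last first.
  rewrite !inE => /andP[sB /eqP cB] ->; rewrite card_f // cB eqxx /=.
  by apply/eqP/setP=> x; rewrite memN !inE !memN opprK orbC.
rewrite !inE => /andP[/eqP cA /eqP NA].
have AN x : (- x \in A) = (x \in A) by rewrite -{2}NA memN.
set B := A :&: lower_half m.
have sB : B \subset lower_half m by apply: subsetIr.
have fB : f B = A :\ 0.
  apply/setP=> x; rewrite in_setD1 in_setU memN !in_setI AN lower_halfN //.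
  case: (boolP (x \in lower_half m)) => [/half0 x0|_].
    by rewrite x0 !andbF orbF andbT.
  by rewrite andbF andbT andbC.
(* Parity: the nonzero part of [A] is [f B], of even size, and [A] itself has even size. *)
have A0 : 0 \notin A.
  apply/negP=> A0; have := cardsD1 0 A; rewrite A0 -fB card_f // cA.
  by move/(congr1 odd); rewrite oddD !odd_double.
have fBA : f B = A.
  by rewrite fB; apply/setP=> x; rewrite !inE andb_idl //; apply: contraL => /eqP->.
exists B => //; rewrite !inE sB /=.
by rewrite -(eqn_pmul2l (isT : 0 < 2)%N) !mul2n -card_f // fBA cA.
Qed.

(* Translating by the centre [a / 2] turns the reflection [i |-> a - i] into
   the negation [i |-> - i]. *)
Lemma reflection_fix (m p : nat) (a : 'I_m.+2) : odd m ->
  #|'Fix_(draws m p.*2 | ('P)^*)[dihedral_perm m true a]%g| = 'C(m./2.+1, p).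
Proof.
move=> om; rewrite fix_drawsE -card_opp_invariant //.
pose c : 'I_m.+2 := a / 2%:R.
have cc : a = c + c.
  rewrite -mulr2n -mulr_natr divrK // (@unitZpE m.+2) //.
  by rewrite coprimen2 /= negbK.
have addKK : cancel (fun A : {set 'I_m.+2} => +%R c @: A) (fun A => +%R (- c) @: A).
  move=> A; rewrite -imset_comp -[RHS]imset_id; apply: eq_imset => x /=.
  by rewrite addKr.
rewrite -[RHS](card_imset _ (can_inj addKK)).
apply: eq_card => A; apply/idP/imsetP => [|[B]]; last first.
  rewrite !inE => /andP[/eqP cB /eqP fB] ->.
  rewrite card_imset ?cB ?eqxx /=; last exact: addrI.
  apply/eqP; rewrite -{2}fB -!imset_comp; apply: eq_imset => x /=.
  by rewrite dihedral_permE cc opprD addrACA subrr add0r.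
rewrite !inE => /andP[/eqP cA /eqP fA]; exists (+%R (- c) @: A); last first.
  rewrite -imset_comp -[LHS]imset_id; apply: eq_imset => x /=.
  by rewrite addrA subrr add0r.
rewrite !inE card_imset ?cA ?eqxx /=; last exact: addrI.
apply/eqP; rewrite -{2}fA -!imset_comp; apply: eq_imset => x /=.
by rewrite dihedral_permE cc !addrA addNr add0r opprD opprK.
Qed.

(** Coprimality leaves the identity as the only contributing rotation, and oddness makes all [m.+2]
    reflections contribute equally. *)
Lemma card_dihedral_orbits (m p : nat) : odd m -> coprime m.+2 p.*2 ->
  (#|orbit ('P)^* (dihedral_set m) @: draws m p.*2| * m.+2.*2
   = 'C(m.+2, p.*2) + m.+2 * 'C(m./2.+1, p))%N.
Proof.
move=> om co; have m_gt0 : (0 < m)%N by case: (m) om.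
rewrite -card_dihedral //.
rewrite -(@Frobenius_Cauchy _ _ _ _ (dihedral_group m)); last exact: acts_draws.
rewrite sum_dihedral //; congr (_ + _)%N.
  under eq_bigr do rewrite rotation_fix //.
  by rewrite -big_mkcond big_pred1_eq.
under eq_bigr do rewrite reflection_fix //.
by rewrite sum_nat_const card_ord.
Qed.

(** * Edges and triangle signs of the wheel *)

Lemma ordSE (m : nat) (i : 'I_m.+2) : ordS i = i + 1.
Proof. by apply: val_inj; rewrite /= addn1. Qed.

Lemma rim_subproof (m : nat) (i : 'I_m.+2) :
  [set Some i; Some (ordS i)] \in edge_set (wheel m.+2).
Proof.
rewrite inE; apply/existsP; exists (Some i); apply/existsP; exists (Some (ordS i)).
by rewrite eqxx andbT /= eqxx andbT ordSE -subr_eq0 opprD addNKr oppr_eq0.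
Qed.

Lemma spoke_subproof (m : nat) (i : 'I_m.+2) :
  [set None; Some i] \in edge_set (wheel m.+2).
Proof.
by rewrite inE; apply/existsP; exists None; apply/existsP; exists (Some i); rewrite eqxx.
Qed.

Definition rim (m : nat) (i : 'I_m.+2) : edge (wheel m.+2) :=
  exist (fun e => e \in edge_set (wheel m.+2)) _ (@rim_subproof m i).

Definition spoke (m : nat) (i : 'I_m.+2) : edge (wheel m.+2) :=
  exist (fun e => e \in edge_set (wheel m.+2)) _ (@spoke_subproof m i).

Lemma wheel_adj_rim (m : nat) (i j : 'I_m.+2) :
  @adj (wheel m.+2) (Some i) (Some j) = (j == i + 1) || (i == j + 1).
Proof.
rewrite /= !ordSE andb_idl // => /orP[]/eqP ->.
  by rewrite -subr_eq0 opprD addNKr oppr_eq0.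
by rewrite -subr_eq0 addrAC subrr add0r.
Qed.

Lemma wheel_edgeP (m : nat) (d : edge (wheel m.+2)) :
  (exists i, d = rim m i) \/ (exists i, d = spoke m i).
Proof.
case: d => e De; have := De; rewrite inE => /existsP[x /existsP[y /andP[xy /eqP De2]]].
case: x y xy De2 => [i|] [j|] //.
- rewrite wheel_adj_rim => /orP[]/eqP-> De2; left.
    by exists i; apply: val_inj; rewrite /= ordSE.
  by exists j; apply: val_inj; rewrite /= ordSE setUC.
- by move=> _ De2; right; exists i; apply: val_inj; rewrite /= setUC.
- by move=> _ De2; right; exists j; apply: val_inj.
Qed.

(** Two distinct indices could give the same edge only if each were the successor of the other, that
    is, if 2 = 0. *)
Lemma rim_inj (m : nat) : (0 < m)%N -> injective (rim m).
Proof.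
move=> m_gt0 i j /(congr1 val) /= /setP e.
have := e (Some i); have := e (Some j).
rewrite !inE !eqxx /= !ordSE !(inj_eq Some_inj) => /orP[/eqP->//|/eqP->].
move/esym/orP => [/eqP|/eqP] //.
move/eqP; rewrite -addrA -subr_eq0 opprD addNKr oppr_eq0.
by rewrite (negPf (@two_neq0 m m_gt0)).
Qed.

Definition triangle_sign (m : nat) (s : signature (wheel m.+2)) (i : 'I_m.+2) :=
  s (spoke m i) (+) s (spoke m (i + 1)) (+) s (rim m i).

(** A vertex of the triangle lies on exactly two of its edges and any other vertex on none, so an
    even number of signs flip. *)
Lemma triangle_sign_switch (m : nat) (u : wheel m.+2) (s : signature (wheel m.+2)) :
  triangle_sign m (switch u s) =1 triangle_sign m s.
Proof.
move=> i; rewrite /triangle_sign !ffunE /= !inE.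
have ne : (i + 1 == i) = false by rewrite -subr_eq0 addrAC subrr add0r.
case: u => [j|] /=; last first.
  by rewrite addbT addbT addbF; case: (s _) (s _) => [] [].
rewrite !(inj_eq Some_inj) ordSE.
have [->|_] := eqVneq j i; last first.
  by case: (j == _) (s _) (s _) (s _) => [] [] [] [].
by rewrite eq_sym ne; case: (s _) (s _) (s _) => [] [] [].
Qed.

Lemma triangle_sign_equiv (m : nat) (s t : signature (wheel m.+2)) :
  switching_equiv s t -> triangle_sign m s =1 triangle_sign m t.
Proof.
move=> /connectP[q]; elim: q s => [|r q IHq] s /=; first by move=> _ ->.
case/andP=> /existsP[u /eqP->] qq e i.
by rewrite -(IHq _ qq e) triangle_sign_switch.
Qed.

(** * Automorphisms of the wheel *)

(** The increments of [h] are 1 or -1. Two consecutive ones of opposite sign would give h(i+2) =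
    h(i), against injectivity, so the increment is constant. *)
Lemma injective_cycle_map (m : nat) (h : 'I_m.+2 -> 'I_m.+2) : (0 < m)%N ->
  injective h -> (forall i, h (i + 1) = h i + 1 \/ h i = h (i + 1) + 1) ->
  exists b, h =1 dihedral_perm m b (h 0).
Proof.
move=> m_gt0 h_inj h_adj.
pose d i := h (i + 1) - h i.
have d1 i : d i = 1 \/ d i = - 1.
  by case: (h_adj i) => e; [left|right]; rewrite /d e 1?addrAC ?subrr ?add0r // opprD addNKr.
have dS i : d (i + 1) = d i.
  have ne : d (i + 1) + d i != 0.
    rewrite /d addrA subrK subr_eq0; apply/eqP=> /h_inj/eqP.
    by rewrite -addrA addrC -subr_eq0 addrK (negPf (@two_neq0 m m_gt0)).
  by case: (d1 (i + 1)) (d1 i) ne => [] -> [] ->; rewrite ?subrr ?addNr ?eqxx.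
(* Every residue is the image of a natural number, so induction along the rim reaches all of
   Z/(m+2). *)
have dE k : d k%:R = d 0 by elim: k => // k IHk; rewrite -natr1 dS.
have hE k : h k%:R = h 0 + d 0 *+ k.
  elim: k => [|k IHk]; first by rewrite addr0.
  by rewrite (mulrSr (d 0)) addrA -IHk -(dE k) /d natr1 addrC subrK.
exists (d 0 == - 1) => i; rewrite dihedral_permE -[i]natr_Zp hE; congr (_ + _).
case: eqP => [->|]; first by rewrite mulNrn.
by case: (d1 0) => ->.
Qed.

(* The rim edge [i] joins the rim vertices [i] and [i + 1], hence the shift by
   one between the actions of a reflection on vertices and on rim edges. *)
Definition vertex_perm (m : nat) (b : bool) (a : 'I_m.+2) : {perm 'I_m.+2} :=
  dihedral_perm m b (if b then a + 1 else a).

Lemma vertex_perm_edge (m : nat) (b : bool) (a i : 'I_m.+2) :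
  let v := vertex_perm m b a in let j := dihedral_perm m b a i in
  v i = j /\ v (i + 1) = j + 1 \/ v i = j + 1 /\ v (i + 1) = j.
Proof.
rewrite /= /vertex_perm !dihedral_permE.
case: b; [right|left]; rewrite ?addrA //.
by rewrite opprD addrACA subrr addr0 addrAC.
Qed.

(** With at least four rim vertices the hub is the only vertex adjacent to all others, hence fixed,
    and the rim is mapped to itself as a cycle. For three rim vertices the wheel is the complete
    graph on four vertices, where this fails. *)
Lemma wheel_iso_dihedral (m : nat) (f : {ffun wheel m.+2 -> wheel m.+2}) :
  (1 < m)%N -> graph_iso f ->
  exists b a, forall x : wheel m.+2, f x = omap (vertex_perm m b a) x.
Proof.
move=> m_gt1 /and3P[/injectiveP f_inj f_surj f_adj].
have m_gt0 : (0 < m)%N by apply: ltnW.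
have adjE x y : adj (f x) (f y) = adj x y.
  by have /forallP/(_ x)/forallP/(_ y)/eqP := f_adj.
have fN : f None = None.
  (* If the hub went to a rim vertex j, the vertex sent to j + 2 would be a non-neighbour of the hub
     other than the hub, as 1, 2 and 3 are nonzero. *)
  case Ef: (f None) => [j|//].
  have /forallP/(_ (Some (j + 2%:R)))/existsP[x /eqP fx] := f_surj.
  have := adjE None x; rewrite Ef fx wheel_adj_rim.
  have -> : (j + 2%:R == j + 1) = false.
    by rewrite (inj_eq (addrI j)) -subr_eq0 addrK oner_eq0.
  have -> : (j == j + 2%:R + 1) = false.
    rewrite -subr_eq0 -addrA opprD addNKr oppr_eq0 natr1.
    by rewrite (negPf (@Zp_natr_neq0 m 3 _)).
  case: x fx => [//|]; rewrite Ef => -[/eqP].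
  by rewrite -subr_eq0 opprD addNKr oppr_eq0 (negPf (@Zp_natr_neq0 m 2 _)).
pose h i := odflt 0 (f (Some i)).
have fS i : f (Some i) = Some (h i).
  by rewrite /h; case Ef: (f _) => [//|]; rewrite -fN in Ef; move/f_inj: Ef.
have h_inj : injective h.
  move=> i j e; suff [] : Some i = Some j :> wheel m.+2 by [].
  by apply: f_inj; rewrite !fS e.
have h_adj i : h (i + 1) = h i + 1 \/ h i = h (i + 1) + 1.
  have := adjE (Some i) (Some (i + 1)); rewrite !fS !wheel_adj_rim eqxx /=.
  by case/orP=> /eqP; [left|right].
have [b hE] := @injective_cycle_map m h m_gt0 h_inj h_adj.
(* [vertex_perm] adds one to the constant of a reflection, so one is subtracted here. *)
exists b, (if b then h 0 - 1 else h 0) => -[i|//] /=; rewrite fS hE.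
by rewrite /vertex_perm; case: b {hE}; rewrite ?subrK.
Qed.

Lemma dihedral_wheel_iso (m : nat) (b : bool) (a : 'I_m.+2) :
  @graph_iso (wheel m.+2) (wheel m.+2) [ffun x => omap (vertex_perm m b a) x].
Proof.
set v := vertex_perm m b a.
apply/and3P; split.
- by apply/injectiveP=> -[i|] [j|]; rewrite !ffunE //= => -[/perm_inj->].
- apply/forallP=> -[i|]; apply/existsP; last by exists None; rewrite ffunE.
  by exists (Some (v^-1%g i)); rewrite ffunE /= permKV.
- apply/forallP=> x; apply/forallP=> y; rewrite !ffunE.
  case: x y => [i|] [j|] //; rewrite !wheel_adj_rim.
  rewrite !dihedral_permE; case: (b); last first.
    by rewrite -!addrA !(inj_eq (addrI _)).
  (* A reflection exchanges successors and predecessors, which the symmetric adjacency absorbs. *)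
  have flip (x y z : 'I_m.+2) : (x - z == x - y + 1) = (y == z + 1).
    rewrite -subr_eq0 -[RHS]subr_eq0; congr (_ == 0); ring.
  by rewrite !flip orbC.
Qed.

Lemma spoke_image (m : nat) (b : bool) (a i : 'I_m.+2) :
  omap (vertex_perm m b a) @: val (spoke m i) = val (spoke m (vertex_perm m b a i)).
Proof. by rewrite /= imsetU !imset_set1. Qed.

Lemma rim_image (m : nat) (b : bool) (a i : 'I_m.+2) :
  omap (vertex_perm m b a) @: val (rim m i) = val (rim m (dihedral_perm m b a i)).
Proof.
rewrite /= imsetU !imset_set1 /= !ordSE.
by case: (@vertex_perm_edge m b a i) => /= -[-> ->] //; rewrite setUC.
Qed.

(** * Switching classes as orbits of sets of negative rim edges *)

Definition neg_rim (m : nat) (s : signature (wheel m.+2)) : {set 'I_m.+2} :=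
  [set i | s (rim m i)].

Lemma spoke_not_outer (m : nat) (i : 'I_m.+2) : spoke m i \notin outer_edges m.+2.
Proof.
rewrite inE; apply/existsP=> -[j /eqP /setP /(_ None)].
by rewrite !inE eqxx.
Qed.

Lemma outer_spoke (m p : nat) (s : signature (wheel m.+2)) (i : 'I_m.+2) :
  s \in outer_signatures p m.+2 -> s (spoke m i) = false.
Proof.
rewrite inE => /andP[/subsetP sub _]; apply/negP=> si.
by have := sub (spoke m i); rewrite inE si (negPf (@spoke_not_outer m i)) => /(_ isT).
Qed.

Lemma outer_triangle_sign (m p : nat) (s : signature (wheel m.+2)) (i : 'I_m.+2) :
  s \in outer_signatures p m.+2 -> triangle_sign m s i = (i \in neg_rim m s).
Proof. by move=> so; rewrite /triangle_sign !(@outer_spoke m p) // inE. Qed.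

(** From left to right, triangle signs survive switching and are carried along by the automorphism;
    with positive spokes they are the signs of the rim edges. Conversely, the dihedral element
    extended by fixing the hub already preserves all signs. *)
Lemma switching_iso_outer (m p : nat) (s t : signature (wheel m.+2)) :
  (1 < m)%N -> s \in outer_signatures p m.+2 -> t \in outer_signatures p m.+2 ->
  switching_iso s t
  = (neg_rim m t \in orbit ('P)^* (dihedral_set m) (neg_rim m s)).
Proof.
move=> m_gt1 so to; apply/existsP/orbitP.
  case=> t' /andP[tt' /existsP[f /andP[f_iso /forallP fE]]].
  have [b [a fv]] := @wheel_iso_dihedral m f m_gt1 f_iso.
  have sign (d d' : edge (wheel m.+2)) : val d' = omap (vertex_perm m b a) @: val d -> t' d' = s d.
    rewrite -(eq_imset _ fv) => e.
    by apply/eqP; have /forallP/(_ d') := fE d; rewrite e eqxx.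
  exists (dihedral_perm m b a); first exact: mem_dihedral.
  (* The triangle on a rim edge goes to the triangle on the image edge, its two spokes possibly
     exchanged. *)
  have key i : triangle_sign m t' (dihedral_perm m b a i) = triangle_sign m s i.
    rewrite /triangle_sign -(sign _ _ (esym (@rim_image m b a i))).
    rewrite -(sign _ _ (esym (@spoke_image m b a i))).
    rewrite -(sign _ _ (esym (@spoke_image m b a (i + 1)))).
    by case: (@vertex_perm_edge m b a i) => /= -[-> ->] //; rewrite [X in X (+) _]addbC.
  apply/setP=> j; rewrite -[j](permKV (dihedral_perm m b a)) /= /setact.
  rewrite mem_imset; last exact: perm_inj.
  rewrite -(@outer_triangle_sign m p s _ so) -(@outer_triangle_sign m p t _ to).
  by rewrite -key (triangle_sign_equiv m _ _ tt').
(* The empty sequence of switchings is used: [t] itself is the intermediate signature. *)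
case=> _ /imsetP[[b a] _ ->] /= st; exists t; rewrite [switching_equiv _ _]connect0 /=.
apply/existsP; exists [ffun x => omap (vertex_perm m b a) x].
rewrite dihedral_wheel_iso; apply/forallP=> d; apply/forallP=> d'.
apply/implyP=> /eqP; rewrite (eq_imset _ (ffunE _)).
case: (@wheel_edgeP m d) => -[i ->].
  rewrite rim_image => /val_inj ->; apply/eqP.
  transitivity (dihedral_perm m b a i \in neg_rim m t); first by rewrite inE.
  by rewrite -st /setact mem_imset ?inE //; apply: perm_inj.
by rewrite spoke_image => /val_inj ->; rewrite !(@outer_spoke m p).
Qed.

Lemma outer_edgesE (m : nat) : outer_edges m.+2 = rim m @: setT.
Proof.
apply/setP=> d; rewrite inE; apply/existsP/imsetP.
  by case=> i /eqP e; exists i; rewrite ?inE //; apply: val_inj.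
by case=> i _ ->; exists i.
Qed.

Lemma neg_edges_outer (m : nat) (s : signature (wheel m.+2)) :
  neg_edges s \subset outer_edges m.+2 -> neg_edges s = rim m @: neg_rim m s.
Proof.
move=> /subsetP sub; apply/setP=> d; apply/idP/imsetP => [sd|[i]].
  have := sub _ sd; rewrite outer_edgesE => /imsetP[i _ di].
  by exists i; rewrite // inE -di; rewrite inE in sd.
by rewrite inE => si ->; rewrite inE.
Qed.

Lemma neg_rim_outer (m p : nat) : (0 < m)%N ->
  neg_rim m @: outer_signatures p m.+2 = draws m p.
Proof.
move=> m_gt0; have r_inj := rim_inj m m_gt0.
apply/setP=> A; apply/imsetP/idP => [[s]|].
  rewrite inE => /andP[so cs] ->; rewrite inE.
  by rewrite -(card_imset _ r_inj) -(neg_edges_outer m s so).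
rewrite inE => cA.
pose s : signature (wheel m.+2) := [ffun d => d \in rim m @: A].
have sE : neg_edges s = rim m @: A by apply/setP=> d; rewrite inE ffunE.
exists s; last by apply/setP=> i; rewrite inE ffunE mem_imset.
by rewrite inE sE card_imset // cA outer_edgesE imsetS // subsetT.
Qed.

(** The class of [x] is the preimage in [D] of the orbit of [f x], and distinct orbits meeting
    [f @: D] have distinct preimages. *)
Lemma card_equivalence_partition_orbit (T rT : finType) (aT : finGroupType)
    (to : {action aT &-> rT}) (G : {group aT}) (R : rel T) (D : {set T})
    (f : T -> rT) :
  {in D &, forall x y, R x y = (f y \in orbit to G (f x))} ->
  #|equivalence_partition R D| = #|orbit to G @: (f @: D)|.
Proof.
move=> RE; pose pre (O : {set rT}) := [set y in D | f y \in O].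
have -> : equivalence_partition R D = pre @: (orbit to G @: (f @: D)).
  rewrite -!imset_comp; apply: eq_in_imset => x xD.
  by apply/setP=> y; rewrite !inE; case: (boolP (y \in D)) => //= yD; rewrite RE.
apply: card_in_imset => _ _ /imsetP[_ /imsetP[x xD ->] ->] /imsetP[_ /imsetP[y yD ->] ->].
move=> /setP/(_ x); rewrite !inE xD orbit_refl /= => /esym.
by move/orbit_eqP.
Qed.

Lemma psi_orbits (m p : nat) : (1 < m)%N ->
  psi p m.+2 = #|orbit ('P)^* (dihedral_set m) @: draws m p|.
Proof.
move=> m_gt1; rewrite -neg_rim_outer; last exact: ltnW.
apply: (@card_equivalence_partition_orbit _ _ _ _ (dihedral_group m)) => s t so to.
exact: switching_iso_outer so to.
Qed.

(** * The closed form for four negative edges *)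

Lemma psi4_bin (k : nat) : (2 <= k)%N -> psi 4 (2 * k + 1) = 'C(k.+1, 3).
Proof.
move=> k2.
have [m om km] : exists2 m, odd m & (2 * k + 1 = m.+2)%N.
  by exists (2 * k - 1)%N; lia.
rewrite km psi_orbits; last lia.
have co : coprime m.+2 4 by rewrite (coprimeXr 2 (_ : coprime m.+2 2)) // coprimen2 /= negbK.
have := @card_dihedral_orbits m 2 om co.
have hm : m./2.+1 = k by have := odd_double_half m; lia.
rewrite hm; set N := #|_|; move: N => N.
(* This substitution turns the falling factorials into products free of truncated predecessors. *)
have [j kj] : exists j, k = j.+2 by exists (k - 2)%N; lia.
have mE : m.+2 = (2 * j + 5)%N by lia.
have := bin_ffact m.+2 4; have := bin_ffact k 2; have := bin_ffact k.+1 3.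
rewrite mE kj /= !ffactnS !ffactn0 !factS fact0.
have -> : (2 * j + 5).-1.-1.-1 = (2 * j + 2)%N by lia.
have -> : (2 * j + 5).-1.-1 = (2 * j + 3)%N by lia.
have -> : (2 * j + 5).-1 = (2 * j + 4)%N by lia.
move: 'C(_, 3) 'C(_, 2) 'C(_, 4) => B3 B2 B4 /= h3 h2 h4 hN.
(* The Burnside identity involves n = 2j + 5 times a binomial, so the other identities are scaled by
   n. The factor 48 = 2 * 4! clears the denominators and leaves a goal linear in the monomials. *)
have := congr1 (muln (2 * j + 5)) h2; have := congr1 (muln (2 * j + 5)) h3.
move=> h3' h2'; apply/eqP; rewrite -(@eqn_pmul2l ((2 * j + 5) * 48)) //; last lia.
by apply/eqP; lia.
Qed.

(** As polynomials in k and l, the right side and the binomial (k + 1 choose 3) differ, but they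
    agree on the lines k = 2l + 2 and k = 2l + 3. *)
Theorem theorem3p2 (n k l : nat) (hk : (2 <= k)%N) (hn : n = (2 * k + 1)%N)
    (hl : l = ((n - 4) %/ 4)%N) :
  (psi 4 (2 * k + 1))%:R =
    (l%:R + 1) * k%:R ^+ 2 - 2 * (l%:R + 1) ^+ 2 * k%:R
    + (2 * l%:R + 1) * (2 * l%:R + 3) * (l%:R + 1) / 3 :> rat.
Proof.
(* The floor of (2k - 3)/4 is k/2 - 1 for k even and (k - 3)/2 for k odd. *)
have kE : k = (2 * l + 2 + odd k)%N by lia.
have k1 : k.-1%:R = k%:R - 1 :> rat by rewrite -subn1 natrB; [|lia].
have : ('C(k.+1, 3) * 6)%N%:R = (k.+1 * (k * k.-1))%N%:R :> rat.
  by rewrite (bin_ffact k.+1 3) !ffactnS ffactn0 muln1.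
rewrite psi4_bin // !natrM k1 -natr1 => binE.
have -> : ('C(k.+1, 3))%:R = (k%:R + 1) * k%:R * (k%:R - 1) / 6 :> rat.
  by apply: (@mulIf _ 6%:R) => //; rewrite binE; field.
have -> : k%:R = 2 * l%:R + 2 + (odd k)%:R :> rat.
  by rewrite [in LHS]kE 2!natrD natrM.
by case: (odd k) => /=; field.
Qed.
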